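(* Let $0<q<n$ be integers, let $U_-,V_-\in\mathbb R^{n\times q}$ and $A\in\mathbb R^{n\times n}$, and suppose that both $A$ and $A^{-1}+U_-V_-^T$ are nonsingular. Let $C_-$ be the matrix defined by $C_-^{-1}=A^{-1}+U_-V_-^T$ and let $H=I_q+V_-^TAU_-$. Then $H$ is nonsingular and $$C_-=A-AU_-H^{-1}V_-^TA .$$
   Context: $I_q$ denotes the $q\times q$ identity matrix. *)

(* Defs.v *)
From mathcomp Require Import all_boot all_order all_algebra.
From mathcomp Require Import reals.
Set Implicit Arguments.
Unset Strict Implicit.
Unset Printing Implicit Defensive.

(* Main.v *)
(* Write B = A^-1 + U V^T = C^-1. From A (U V^T) C = A (B - A^-1) C = A - C,
   the matrix I - V^T C U is an inverse of H. From V^T A B = H V^T, the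
   right-hand side of the formula multiplied by B is I. *)
Require Import Defs.
From mathcomp Require Import all_boot all_order all_algebra.
From mathcomp Require Import reals.
Set Implicit Arguments.
Unset Strict Implicit.
Unset Printing Implicit Defensive.
Import Order.TTheory GRing.Theory Num.Theory.
Local Open Scope ring_scope.

(** Since [U *m W] is the difference of the inverses of [C] and [A], the quadratic term of the
    expanded product collapses to [W *m A *m U - W *m C *m U], which cancels both linear terms. *)
Lemma sub1mx_right_inverse (F : comUnitRingType) (n q : nat)
    (U : 'M[F]_(n, q)) (W : 'M[F]_(q, n)) (A C : 'M[F]_n) :
  A \in unitmx -> C \in unitmx -> invmx C = invmx A + U *m W ->
  (1%:M + W *m A *m U) *m (1%:M - W *m C *m U) = 1%:M.
Proof.
move=> uA uC eC.
have eAC : A *m (U *m W) *m C = A - C.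
  have -> : U *m W = invmx C - invmx A by rewrite eC addrC addKr.
  by rewrite mulmxBr mulmxV // mulmxBl mul1mx mulmxKV.
have eW : W *m A *m U *m (W *m C *m U) = W *m A *m U - W *m C *m U.
  by rewrite -mulmxBl -mulmxBr -eAC !mulmxA.
by rewrite mulmxBr mulmx1 mulmxDl mul1mx eW addrCA subrr addr0 addrK.
Qed.

Lemma woodbury (F : comUnitRingType) (n q : nat)
    (U : 'M[F]_(n, q)) (W : 'M[F]_(q, n)) (A C : 'M[F]_n) :
  A \in unitmx -> C \in unitmx -> invmx C = invmx A + U *m W ->
  1%:M + W *m A *m U \in unitmx ->
  C = A - A *m U *m invmx (1%:M + W *m A *m U) *m W *m A.
Proof.
move=> uA uC eC; set H := 1%:M + _ => uH.
have eAC : A *m invmx C = 1%:M + A *m U *m W.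
  by rewrite eC mulmxDr mulmxV // mulmxA.
have eWAC : W *m A *m invmx C = H *m W.
  by rewrite -mulmxA eAC mulmxDr mulmx1 mulmxDl mul1mx !mulmxA.
suff e1 : (A - A *m U *m invmx H *m W *m A) *m invmx C = 1%:M.
  by rewrite -[LHS]mul1mx -e1 mulmxKV.
(* The factor [H] supplied by [eWAC] cancels [invmx H], so the subtracted term becomes
   [A *m U *m W], the excess of [A *m invmx C] over the identity. *)
rewrite mulmxBl eAC -(mulmxA _ W A) -(mulmxA _ (W *m A)) eWAC mulmxA.
by rewrite mulmxKV // addrK.
Qed.

Theorem corollary2p1 (R : realType) (n q : nat) (hqn : (0 < q < n)%N)
    (U V : 'M[R]_(n, q)) (A : 'M[R]_n)
    (hA : A \in unitmx)
    (hAUV : invmx A + U *m V^T \in unitmx)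
    (C : 'M[R]_n) (hC : invmx C = invmx A + U *m V^T)
    (H : 'M[R]_q) (hH : H = 1%:M + V^T *m A *m U) :
  H \in unitmx /\
  C = A - A *m U *m invmx H *m V^T *m A.
Proof.
(* [invmx] returns a singular matrix unchanged, so invertibility of [invmx C] forces that of [C]. *)
have uC : C \in unitmx by rewrite -unitmx_inv hC.
have uH : H \in unitmx.
  (* For square matrices over a commutative ring, a right inverse suffices. *)
  by rewrite hH; case: (mulmx1_unit (sub1mx_right_inverse hA uC hC)).
by split=> //; rewrite hH; apply: woodbury => //; rewrite -hH.
Qed.
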